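(* Let $r\ge 2$ and $s\ge 2$ be integers and let $P$ be a finite $(\mathbf{r}+\mathbf{s})$-free poset of width $w$. Then, for every order in which the elements of $P$ are presented, the First-Fit algorithm partitions $P$ into at most $8(r-1)(s-1)w$ chains.
   Context: A chain is a set of pairwise comparable elements, an antichain a set of pairwise incomparable elements; the width of a poset is the size of a largest antichain. For posets $P,Q$, $P+Q$ is the poset formed by disjoint copies of $P$ and $Q$ in which every element of the copy of $P$ is incomparable to every element of the copy of $Q$. $\mathbf{r}$ denotes a chain with $r$ elements. A poset is $Q$-free if no induced subposet is isomorphic to $Q$; thus $P$ is $(\mathbf{r}+\mathbf{s})$-free if it does not contain two chains of sizes $r$ and $s$ such that every element of the first is incomparable to every element of the second. First-Fit is the on-line chain partitioning algorithm: elements are revealed one at a time and, using positive integers as colors, each new element $x$ receives the least color $j$ such that $x$ together with all elements previously colored $j$ forms a chain; the color classes form the chain partition. *)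

(* Defs.v *)
From HB Require Import structures.
From mathcomp Require Import all_boot all_order.

Set Implicit Arguments.
Unset Strict Implicit.
Unset Printing Implicit Defensive.

Import Order.TTheory.

Definition is_chain (d : Order.disp_t) (T : finPOrderType d) (A : {set T}) :=
  [forall x in A, forall y in A, (x >=< y)%O].

Definition is_antichain (d : Order.disp_t) (T : finPOrderType d)
    (A : {set T}) :=
  [forall x in A, forall y in A, (x != y) ==> (x >< y)%O].

Definition width (d : Order.disp_t) (T : finPOrderType d) : nat :=
  \max_(A : {set T} | is_antichain A) #|A|.

Definition psum (P Q : Type) : Type := (P + Q)%type.

HB.instance Definition _ (P Q : choiceType) :=
  Choice.copy (psum P Q) (P + Q)%type.

Fact psum_display : Order.disp_t. Proof. exact: (Order.Disp tt tt). Qed.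

Section ParallelSum.
Context (d1 d2 : Order.disp_t) (P : porderType d1) (Q : porderType d2).

Definition psum_le (u v : psum P Q) : bool :=
  match u, v with
  | inl x, inl y => (x <= y)%O
  | inr x, inr y => (x <= y)%O
  | _, _ => false
  end.

Lemma psum_le_refl : reflexive psum_le.
Proof. by case=> x /=; apply: lexx. Qed.

Lemma psum_le_anti : antisymmetric psum_le.
Proof. by case=> x [] y //= /le_anti ->. Qed.

Lemma psum_le_trans : transitive psum_le.
Proof. by case=> x [] y [] z //=; apply: le_trans. Qed.

HB.instance Definition _ := Order.Le_isPOrder.Build psum_display (psum P Q)
  psum_le_refl psum_le_anti psum_le_trans.
End ParallelSum.

Definition poset_free (dQ d : Order.disp_t) (Q : porderType dQ)
    (T : porderType d) : Prop :=
  ~ exists2 f : Q -> T, injective f & {mono f : x y / (x <= y)%O}.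

(* 'I_r with its natural order is the chain with r elements. *)
Definition rs_free (d : Order.disp_t) (r s : nat) (T : porderType d) : Prop :=
  poset_free (psum 'I_r 'I_s) T.

Section FirstFit.
Context (d : Order.disp_t) (T : finPOrderType d).

(* A partial colouring maps each element to its (positive) colour, and the
   elements not presented so far to 0. *)
Definition color_class (c : {ffun T -> nat}) (j : nat) : {set T} :=
  [set y | c y == j].

Definition admissible (c : {ffun T -> nat}) (x : T) (j : nat) : bool :=
  (0 < j) && is_chain (x |: color_class c j).

Lemma admissible_ex (c : {ffun T -> nat}) (x : T) :
  exists j, admissible c x j.
Proof.
exists (\max_y c y).+1; apply/andP; split=> //.
have -> : color_class c (\max_y c y).+1 = set0.
  apply/setP=> y; rewrite !inE; apply/eqP=> cy.
  by have := leq_bigmax (F := c) y; rewrite cy ltnn.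
by rewrite setU0; apply/forall_inP=> y /set1P->; apply/forall_inP=> z /set1P->;
  apply: comparablexx.
Qed.

Definition ff_color (c : {ffun T -> nat}) (x : T) : nat :=
  ex_minn (admissible_ex c x).

Definition ff_step (c : {ffun T -> nat}) (x : T) : {ffun T -> nat} :=
  [ffun y => if y == x then ff_color c x else c y].

Definition first_fit (o : seq T) : {ffun T -> nat} :=
  foldl ff_step [ffun=> 0] o.

Definition first_fit_classes (o : seq T) : {set {set T}} :=
  [set color_class (first_fit o) (first_fit o x) | x : T].

End FirstFit.

(* Main.v *)
Require Import Defs.
From HB Require Import structures.
From mathcomp Require Import all_boot all_order zify.

(** Rank the poset by a strictly increasing [f] and attach to [x] the interval
    from [f x] to the largest rank of an element equal or incomparable to [x].
    Incomparable elements get intersecting intervals. For [f] the size of the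
    strict down-set (when [r = 2] or [s = 2]) or the height (when [r, s >= 3]),
    (r+s)-freeness forbids chains of more than [(r-1)(s-1)] elements whose
    intervals share a point, so every point lies in at most
    [b := (r-1)(s-1)w] intervals.

    Process the First-Fit colours in increasing order on the points of the
    line ("columns"). A column lying in an interval of the current colour gains
    score 3; otherwise, if a neighbouring surviving column does, its score is
    unchanged; otherwise it loses 1, and dies if its score was 0. Since every
    element meets an incomparable one of each smaller colour, every interval of
    colour [>= i] still contains a surviving column at time [i]. If a
    survivor of score [S] lies in [R] processed intervals, and [bl], [br] of its
    steps saw the colour on its left, right neighbour, then
    [i + S <= 4 R + bl + br], and amortising [bl] and [br] against the scores of
    the neighbours gives [4 bl, 4 br <= i + S] when [S] is maximal. Hence the
    last colour [m] satisfies [m <= 8 R <= 8 b]. *)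

Set Implicit Arguments.
Unset Strict Implicit.
Unset Printing Implicit Defensive.

Import Order.TTheory.

(** * Walls on graphs of bounded pathwidth *)

Section Columns.
Variables (N : nat).
Implicit Types (A H : {set 'I_N}) (S : 'I_N -> nat) (u v : 'I_N).

Definition left_nbr A u v :=
  [&& u \in A, u < v & [forall x in A, ~~ (u < x < v)]].

Definition right_nbr A u v :=
  [&& u \in A, v < u & [forall x in A, ~~ (v < x < u)]].

Lemma left_nbr_uniq A u u' v : left_nbr A u v -> left_nbr A u' v -> u = u'.
Proof.
case/and3P=> uA uv /forall_inP hu /and3P[uA' uv' /forall_inP hu'].
by apply: val_inj => /=; have := hu _ uA'; have := hu' _ uA; lia.
Qed.

Lemma right_nbr_uniq A u u' v : right_nbr A u v -> right_nbr A u' v -> u = u'.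
Proof.
case/and3P=> uA uv /forall_inP hu /and3P[uA' uv' /forall_inP hu'].
by apply: val_inj => /=; have := hu _ uA'; have := hu' _ uA; lia.
Qed.

Lemma left_nbr_sub A A' u v :
  A' \subset A -> u \in A' -> left_nbr A u v -> left_nbr A' u v.
Proof.
move=> /subsetP sA uA' /and3P[_ uv /forall_inP hu]; apply/and3P; split=> //.
by apply/forall_inP=> x /sA /hu.
Qed.

Lemma right_nbr_sub A A' u v :
  A' \subset A -> u \in A' -> right_nbr A u v -> right_nbr A' u v.
Proof.
move=> /subsetP sA uA' /and3P[_ uv /forall_inP hu]; apply/and3P; split=> //.
by apply/forall_inP=> x /sA /hu.
Qed.

(** The last element of [A] before [p] and the first one from [p] on have no element of [A] between
    them. *)
Lemma nbr_across A (p : nat) a b : a \in A -> b \in A -> a < p -> p <= b ->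
  exists a' b' : 'I_N, [/\ a <= a' < p, p <= b' <= b, b' \in A,
     left_nbr A a' b' & right_nbr A b' a'].
Proof.
move=> aA bA ap pb.
have Pa : (a \in A) && (a < p) by rewrite aA.
have Pb : (b \in A) && (p <= b) by rewrite bA.
case: (@arg_maxnP _ a (fun x : 'I_N => (x \in A) && (x < p)) val Pa)
  => a' /andP[a'A a'p] maxa.
case: (@arg_minnP _ b (fun x : 'I_N => (x \in A) && (p <= x)) val Pb)
  => b' /andP[b'A b'p] minb.
have /= aa' := maxa _ Pa; have /= bb' := minb _ Pb.
have gap x : x \in A -> ~~ (a' < x < b').
  move=> xA; case: (ltnP x p) => xp.
    by have /= := maxa x; rewrite xA xp => /(_ isT); lia.
  by have /= := minb x; rewrite xA xp => /(_ isT); lia.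
exists a', b'; split=> //; rewrite ?aa' ?b'p ?bb' //.
  by apply/and3P; split=> //; [lia | apply/forall_inP].
by apply/and3P; split=> //; [lia | apply/forall_inP].
Qed.

Definition touched A H v :=
  [|| v \in H, [exists u in H, left_nbr A u v]
    | [exists u in H, right_nbr A u v]].

Definition next_alive A S H := [set v in A | touched A H v || (0 < S v)].

Definition next_score A S H v :=
  if v \in H then S v + 3 else if touched A H v then S v else (S v).-1.

(* [b] counts the steps at which the current neighbour on one side of [v]
   carried the current colour. *)
Definition side_bound (nbr : {set 'I_N} -> rel 'I_N) A S (i b : nat) v :=
  4 * b <= i \/ exists2 u, nbr A u v & 4 * b <= i + S u.

(** A hit on the neighbour [u] adds 4 on the left, paid by 1 from [i] and 3 from [S u]. A decrement
    of [S u] is offset by the growth of [i]; a neighbour that dies had score 0, so the bound then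
    holds without it. *)
Lemma side_bound_step (nbr : {set 'I_N} -> rel 'I_N) A S H i b v :
  (forall A u v, nbr A u v -> u \in A) ->
  (forall A u u' v, nbr A u v -> nbr A u' v -> u = u') ->
  (forall A A' u v, A' \subset A -> u \in A' -> nbr A u v -> nbr A' u v) ->
  side_bound nbr A S i b v ->
  side_bound nbr (next_alive A S H) (next_score A S H) i.+1
    (b + [exists u in H, nbr A u v]) v.
Proof.
move=> nbrA nbr_uniq nbr_sub hb.
have sub : next_alive A S H \subset A.
  by apply/subsetP=> x; rewrite inE => /andP[].
have alive u : nbr A u v -> touched A H u || (0 < S u) ->
    nbr (next_alive A S H) u v.
  move=> nu tu; have uA := nbrA _ _ _ nu.
  by apply: nbr_sub sub _ nu; rewrite inE uA tu.
case: exists_inP => [[u uH nu]|nH].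
  right; exists u; first by apply: alive => //; rewrite /touched uH.
  rewrite /next_score uH; case: hb => [|[u' nu']]; first by lia.
  by rewrite (nbr_uniq _ _ _ _ nu' nu); lia.
case: hb => [|[u nu]]; first by left; lia.
have uH : u \notin H by apply/negP=> uH; case: nH; exists u.
case tu : (touched A H u).
  right; exists u; first by apply: alive; rewrite ?tu.
  by rewrite /next_score (negbTE uH) tu; lia.
case: (posnP (S u)) => Su; first by left; lia.
right; exists u; first by apply: alive; rewrite ?Su ?orbT.
by rewrite /next_score (negbTE uH) tu; lia.
Qed.

(** * Intervals with a wall colouring *)

Section Colouring.
Variables (T : finType) (E : rel T) (c lo hi : T -> nat) (b : nat).
Hypothesis lo_hi : forall x, lo x <= hi x.
Hypothesis hi_lt : forall x, hi x < N.
Hypothesis E_meet : forall x y, E x y -> lo x <= hi y /\ lo y <= hi x.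
Hypothesis bag_le : forall t, #|[set x | lo x <= t <= hi x]| <= b.
Hypothesis wall : forall x i, 0 < i < c x -> exists2 y, E x y & c y = i.

Definition coloured_columns i : {set 'I_N} :=
  [set v : 'I_N | [exists x, (c x == i) && (lo x <= v <= hi x)]].

(** Different colours seen at [v] come from different intervals through [v]. *)
Lemma count_coloured_columns v i :
  count (fun j : nat => v \in coloured_columns j) (iota 1 i) <= b.
Proof.
apply: leq_trans (bag_le v); rewrite cardE -size_filter -(size_map c).
apply: uniq_leq_size; first by rewrite filter_uniq ?iota_uniq.
move=> j; rewrite mem_filter inE => /andP[/existsP[x /andP[/eqP <- hx]] _].
by apply: map_f; rewrite mem_enum inE.
Qed.

(** If neither given survivor lies in the other interval, crossing the left end of the right-hand
    interval yields adjacent survivors, one in each interval. *)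
Lemma touched_of_meet A x y v u :
  v \in A -> lo x <= v <= hi x -> u \in A -> lo y <= u <= hi y ->
  lo x <= hi y -> lo y <= hi x ->
  exists2 v' : 'I_N, lo x <= v' <= hi x &
    (v' \in A) && touched A (coloured_columns (c y)) v'.
Proof.
move=> vA hv uA hu xy yx.
have col (t : 'I_N) : lo y <= t <= hi y -> t \in coloured_columns (c y).
  by move=> ht; rewrite inE; apply/existsP; exists y; rewrite eqxx.
case: (boolP (lo y <= v <= hi y)) => [vy|nvy].
  by exists v; rewrite // vA /touched col.
case: (boolP (lo x <= u <= hi x)) => [ux|nux].
  by exists u; rewrite // uA /touched col.
case: (ltnP v u) => [vu|uv].
  have [||a [a' [h1 h2 a'A la ra]]] := @nbr_across A (lo y) v u vA uA; try lia.
  have aA : a \in A by case/and3P: la.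
  exists a; first by lia.
  rewrite aA /touched; apply/or3P/Or33/exists_inP; exists a' => //.
  by apply: col; lia.
have [||a [a' [h1 h2 a'A la ra]]] := @nbr_across A (lo x) u v uA vA; try lia.
exists a'; first by lia.
rewrite a'A /touched; apply/or3P/Or32/exists_inP; exists a => //.
by apply: col; lia.
Qed.

Lemma column_process i : exists A S,
  (forall x, i <= c x -> exists2 v : 'I_N, lo x <= v <= hi x & v \in A) /\
  (forall v, v \in A -> exists bl br,
     [/\ i + S v <=
           4 * count (fun j : nat => v \in coloured_columns j) (iota 1 i)
           + bl + br,
         side_bound left_nbr A S i bl v & side_bound right_nbr A S i br v]).
Proof.
elim: i => [|i [A [S [hA hS]]]].
  exists setT, (fun=> 0); split=> [x _|v _].
    by exists (Ordinal (hi_lt x)); rewrite ?inE //= lo_hi leqnn.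
  by exists 0, 0; split=> //; left.
set H := coloured_columns i.+1.
exists (next_alive A S H), (next_score A S H); split=> [x ix|v].
  (* [y] is [x] itself if it has colour [i.+1], and otherwise comes from [wall]. *)
  have [y [cy xy yx]] : exists y, [/\ c y = i.+1, lo x <= hi y & lo y <= hi x].
    move: ix; rewrite leq_eqVlt => /predU1P[->|ix]; first by exists x.
    by have [y /E_meet[? ?] cy] := wall (x := x) (i := i.+1) ix; exists y.
  have [|v hv vA] := hA x; first exact: ltnW.
  have [|u hu uA] := hA y; first by rewrite cy.
  have [v' hv' /andP[v'A]] := touched_of_meet vA hv uA hu xy yx.
  by rewrite cy => tv; exists v'; rewrite // inE v'A tv.
rewrite inE => /andP[vA tv]; have [bl [br [h hl hr]]] := hS v vA.
exists (bl + [exists u in H, left_nbr A u v]).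
exists (br + [exists u in H, right_nbr A u v]); split; first last.
- apply: side_bound_step hr => [? ? ? /and3P[]//||].
    exact: right_nbr_uniq.
  exact: right_nbr_sub.
- apply: side_bound_step hl => [? ? ? /and3P[]//||].
    exact: left_nbr_uniq.
  exact: left_nbr_sub.
(* A hit on [v] raises both sides by 4; a hit on a neighbour only is paid by [bl] or [br]; with no
   hit, survival means [0 < S v], and the lost point offsets the new step. *)
rewrite -(addn1 i) iotaD count_cat /= addn0 add1n -/H /next_score.
move: h tv; set n := count _ _.
rewrite /touched; case: (v \in H) => /=; first by lia.
case: [exists u in H, left_nbr A u v];
  case: [exists u in H, right_nbr A u v];
  rewrite /=; lia.
Qed.

(* A survivor of maximal score dominates the scores of its neighbours. *)
Lemma wall_le_bag x : c x <= 8 * b.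
Proof.
have [A [S [/(_ x (leqnn _)) [v0 _ v0A] hS]]] := column_process (c x).
case: (arg_maxnP S v0A) => v vA maxS.
have [bl [br [h hl hr]]] := hS v vA.
have bd (nbr : {set 'I_N} -> rel 'I_N) d : (forall u, nbr A u v -> u \in A) ->
    side_bound nbr A S (c x) d v -> 4 * d <= c x + S v.
  by move=> nA [|[u /nA/maxS /= ? ?]]; lia.
have hbl : 4 * bl <= c x + S v by apply: bd hl => u /and3P[].
have hbr : 4 * br <= c x + S v by apply: bd hr => u /and3P[].
(* The two side bounds absorb half of [c x + S v], so it is at most 8 times the count. *)
have := count_coloured_columns v (c x); lia.
Qed.
End Colouring.
End Columns.

(** * Interval representation of the incomparability graph *)

Section Posets.
Context (d : Order.disp_t) (P : finPOrderType d).
Implicit Types (x y z : P) (B : {set P}).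

Definition no_chain_pair (r s : nat) := forall a b : seq P,
  sorted <%O a -> sorted <%O b -> size a = r -> size b = s ->
  ~ {in a & b, forall x y, (x >< y)%O}.

Lemma rs_free_no_chain_pair r s : 0 < r -> rs_free r s P -> no_chain_pair r s.
Proof.
move=> r0 hfree a b sa sb ra rb inc; apply: hfree.
(* [x0] serves only as the default value of [nth]. *)
have [x0 _] : exists x, x \in a.
  case: a ra r0 {sa inc} => [<-//|x a _ _].
  by exists x; rewrite mem_head.
pose f (u : psum 'I_r 'I_s) := match u with
  inl i => nth x0 a i | inr j => nth x0 b j end.
have f_mono : {mono f : x y / (x <= y)%O}.
  case=> i [] j; rewrite /f.
  - by rewrite (lt_sorted_leq_nth x0 sa) // inE ra ltn_ord.
  - rewrite incomparable_leF //; apply: inc;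
      by rewrite mem_nth ?ra ?rb.
  - rewrite incomparable_leF // comparable_sym; apply: inc;
      by rewrite mem_nth ?ra ?rb.
  - by rewrite (lt_sorted_leq_nth x0 sb) // inE rb ltn_ord.
by exists f => //; apply: inc_inj.
Qed.

Lemma no_chain_pairC r s : no_chain_pair r s -> no_chain_pair s r.
Proof.
move=> h a b sa sb ra rb inc; apply: (h b a) => // x y xb ya.
by rewrite comparable_sym inc.
Qed.

Lemma le_width B : is_antichain B -> #|B| <= width P.
Proof. by move=> aB; apply: (bigop.bigmax_sup B). Qed.

(** The minimal elements of [B] form an antichain, and removing them shortens the longest chains,
    since each remaining chain extends downwards. *)
Lemma card_le_height_width k B :
  (forall a : seq P, sorted <%O a -> {subset a <= B} -> size a <= k) ->
  #|B| <= k * width P.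
Proof.
elim: k B => [|k IHk] B hB.
  rewrite mul0n leqn0 cards_eq0; apply/eqP/setP=> x; rewrite inE.
  apply/negP=> xB; suff: size [:: x] <= 0 by [].
  by apply: hB => // y; rewrite inE => /eqP->.
pose M := [set x in B | [forall y in B, ~~ (y < x)%O]].
have MB : M \subset B by apply/subsetP=> x; rewrite inE => /andP[].
have aM : is_antichain M.
  apply/forall_inP=> x; rewrite inE => /andP[xB /forall_inP hx].
  apply/forall_inP=> y; rewrite inE => /andP[yB /forall_inP hy].
  have := hx _ yB; have := hy _ xB; rewrite /Order.comparable.
  by case: (comparableP x y).
rewrite -(cardsID M B) (setIidPr MB) mulSn leq_add ?le_width //.
apply: IHk => a sa aB.
case: a => [//|x a] in sa aB *.
have /[!inE] /andP[xM xB] : x \in B :\: M by apply: aB; rewrite mem_head.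
have [y yB yx] : exists2 y, y \in B & (y < x)%O.
  move: xM; rewrite xB negb_forall => /existsP[y].
  by rewrite negb_imply negbK => /andP[yB yx]; exists y.
apply: (hB (y :: x :: a)) => [|z]; first by rewrite /= yx.
by rewrite inE => /predU1P[->//|/aB]; rewrite inE => /andP[].
Qed.

Lemma sorted_lt_head x a :
  sorted <%O (x :: a) -> forall y, y \in x :: a -> (x <= y)%O.
Proof.
rewrite lt_sorted_pairwise /= => /andP[/allP h _] y.
by rewrite inE => /predU1P[->//|/h/ltW].
Qed.

Lemma sorted_lt_last x a y :
  sorted <%O (x :: a) -> y \in x :: a -> (y <= last x a)%O.
Proof.
elim: a x y => [|z a IHa] x y /=; first by rewrite inE => _ /eqP->.
case/andP=> xz sz; rewrite inE => /predU1P[->|/(IHa _ _ sz)//].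
exact: le_trans (ltW xz) (IHa _ _ sz (mem_head _ _)).
Qed.

Lemma sorted_head_lt_last x a :
  sorted <%O (x :: a) -> 0 < size a -> (x < last x a)%O.
Proof.
case: a => [//|z a] /= /andP[xz sz] _.
exact: lt_le_trans xz (sorted_lt_last sz (mem_head _ _)).
Qed.

(** * Bag sizes from a rank function *)

Section Bags.
Variables (f : P -> nat) (k : nat).
Hypothesis f_lt : {homo f : x y / (x < y)%O >-> x < y}.
Hypothesis f_gap : forall x a y, sorted <%O (x :: a) -> size a = k.+1 ->
  {in x :: a, forall z, (y >< z)%O} -> f y < f (last x a).

Definition last_rival x := \max_(y | (y == x) || (y >< x)%O) f y.

Lemma le_last_rival x : f x <= last_rival x.
Proof. by apply: (bigop.bigmax_sup x); rewrite ?eqxx. Qed.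

Lemma incomparable_le_last_rival x y : (x >< y)%O -> f x <= last_rival y.
Proof. by move=> xy; apply: (bigop.bigmax_sup x); rewrite ?xy ?orbT. Qed.

Lemma last_rivalP x :
  exists2 y, (y == x) || (y >< x)%O & last_rival x = f y.
Proof.
have Px : (x == x) || (x >< x)%O by rewrite eqxx.
by exists [arg max_(y > x | (y == x) || (y >< x)%O) f y];
  [case: arg_maxnP | rewrite /last_rival (bigop.bigmax_eq_arg x)].
Qed.

(** In a chain of [k.+2] elements of the bag, the rival of the bottom element has rank at least [t],
    hence at least that of the top, and so is incomparable to the whole chain, against [f_gap]. *)
Lemma card_bag t : #|[set x | f x <= t <= last_rival x]| <= k.+1 * width P.
Proof.
apply: card_le_height_width => a sa aB; rewrite leqNgt; apply/negP=> ka.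
have {}sa : sorted <%O (take k.+2 a) by apply: take_sorted.
have {}aB : {subset take k.+2 a <= [set x | f x <= t <= last_rival x]}.
  by move=> z /mem_take/aB.
have : size (take k.+2 a) = k.+2 by rewrite size_take; case: ltnP; lia.
case: (take _ a) => [//|x b] in sa aB * => [[kb]].
have fl : f (last x b) <= t.
  by have := aB _ (mem_last x b); rewrite inE => /andP[].
have := aB _ (mem_head x b); rewrite inE => /andP[_].
have xl : (x < last x b)%O.
  by apply: sorted_head_lt_last; rewrite ?kb.
have [y /predU1P[->|yx] ->] := last_rivalP x; first by have := f_lt xl; lia.
move=> ty; have := f_gap sa kb.
have : f (last x b) <= f y by apply: leq_trans ty.
rewrite leqNgt => /negP fly /(_ y) h; apply/fly/h => z zb.
apply/negP; rewrite /Order.comparable => /orP[yz|zy].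
  apply: fly; move: yz; rewrite le_eqVlt => /predU1P[eyz|yz].
    by move: yx; rewrite eyz /Order.comparable (sorted_lt_head sa) // orbT.
  exact/f_lt/(lt_le_trans yz)/sorted_lt_last.
move/negP: yx; apply; apply: ge_comparable.
by apply: le_trans zy; apply: (sorted_lt_head sa).
Qed.
End Bags.

(** * Two rank functions: down-set size and height *)

Definition down_card x := #|[set z | (z < x)%O]|.

Lemma down_card_lt : {homo down_card : x y / (x < y)%O >-> x < y}.
Proof.
move=> x y xy; apply/proper_card/properP; split.
  by apply/subsetP=> z; rewrite !inE => /lt_trans; apply.
by exists x; rewrite !inE ?ltxx.
Qed.

(** An element below [y] but not below the top of the chain would form with [y] a forbidden 2-chain.
    The inclusion of down-sets is strict because of [x]. *)
Lemma down_card_gap k : no_chain_pair 2 k.+2 ->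
  forall x a y, sorted <%O (x :: a) -> size a = k.+1 ->
  {in x :: a, forall z, (y >< z)%O} -> down_card y < down_card (last x a).
Proof.
move=> free x a y sa ka inc; apply/proper_card/properP; split; last first.
  exists x; rewrite !inE; last first.
    by rewrite incomparable_ltF // comparable_sym inc ?mem_head.
  by apply: sorted_head_lt_last; rewrite ?ka.
apply/subsetP=> z; rewrite !inE => zy; apply/negPn/negP=> nzl.
apply: (free [:: z; y] (x :: a)) => //=; rewrite ?zy ?ka // => u v.
rewrite !inE => /pred2P[]-> hv; last exact: inc.
apply/negP; rewrite /Order.comparable => /orP[zv|vz].
  move: zv; rewrite le_eqVlt => /predU1P[zv|zv].
    by have := inc _ hv; rewrite -zv /Order.comparable (ltW zy) orbT.
  by case/negP: nzl; apply: lt_le_trans zv (sorted_lt_last sa hv).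
by have := inc _ hv; rewrite /Order.comparable (le_trans vz (ltW zy)) orbT.
Qed.

Definition height x :=
  \max_(n < #|P| | [exists a : n.-tuple P, path >%O x a]) n.

Lemma height_pathP x : exists2 a : seq P, path >%O x a & size a = height x.
Proof.
have P0 : 0 < #|P| by apply/card_gt0P; exists x.
pose Q (n : 'I_#|P|) := [exists a : n.-tuple P, path >%O x a].
have Q0 : Q (Ordinal P0) by apply/existsP; exists [tuple].
rewrite /height (bigop.bigmax_eq_arg (Ordinal P0)) //.
case: arg_maxnP => // n /existsP[a pa] _.
by exists a; rewrite ?size_tuple.
Qed.

Lemma size_path_height x a : path >%O x a -> size a <= height x.
Proof.
move=> pa; have ua : uniq (x :: a).
  by apply: (@sorted_uniq _ >%O) => // [? ? ? h1 h2|?];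
    [apply: lt_trans h2 h1 | apply: ltxx].
have sa : size a < #|P|.
  by have := max_card (mem (x :: a)); rewrite (card_uniqP ua).
apply: (bigop.bigmax_sup (Ordinal sa)) => //.
by apply/existsP; exists (in_tuple a).
Qed.

Lemma height_lt : {homo height : x y / (x < y)%O >-> x < y}.
Proof.
move=> x y xy; have [a pa <-] := height_pathP x.
by have := @size_path_height y (x :: a); rewrite /= pa /= andbT; apply.
Qed.

Lemma height_pred y n : height y = n.+1 -> exists2 z, (z < y)%O & height z = n.
Proof.
have [a pa sa] := height_pathP y; case: a pa sa => [_ <- //|z a] /=.
case/andP=> zy /size_path_height ha sa hy; exists z => //.
by apply/eqP; rewrite eqn_leq -ltnS -hy height_lt //= -ltnS -hy -sa ltnS.
Qed.

(* A maximal chain below [y] loses one unit of height at each step. *)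
Lemma height_chain y n : n <= height y -> exists b : seq P,
  [/\ sorted <%O b, size b = n.+1 &
      {in b, forall z, (z <= y)%O /\ height y <= height z + n}].
Proof.
elim: n y => [|n IHn] y ny.
  by exists [:: y]; split=> // z; rewrite inE => /eqP->; rewrite addn0.
have [m hm] : exists m, height y = m.+1 by exists (height y).-1; lia.
have [z zy hz] := height_pred hm.
have [|b [sb size_b hb]] := IHn z; first by lia.
exists (rcons b y); split; last 2 first.
- by rewrite size_rcons size_b.
- move=> u; rewrite mem_rcons inE => /predU1P[->|/hb[uz hu]].
    by rewrite lexx; split=> //; lia.
  by split; [apply: le_trans uz (ltW zy) | lia].
rewrite lt_sorted_pairwise pairwise_rcons -lt_sorted_pairwise sb andbT.
by apply/allP=> u /hb[uz _]; apply: le_lt_trans zy.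
Qed.

Lemma height_sorted x a :
  sorted <%O (x :: a) -> height x + size a <= height (last x a).
Proof.
elim: a x => [|z a IHa] x /=; first by rewrite addn0.
by case/andP=> /height_lt xz /IHa; lia.
Qed.

(** Otherwise [y] is at least [s] higher than [z], the top of the lowest [r.+1] elements. The [s.+1]
    elements of a chain ending at [y] then have height at least that of [z], so none is below those
    elements; none is above them either, as [y] is not. *)
Lemma height_gap r s : no_chain_pair r.+1 s.+1 ->
  forall x a y, sorted <%O (x :: a) -> size a = r + s ->
  {in x :: a, forall z, (y >< z)%O} -> height y < height (last x a).
Proof.
move=> free x a y sa size_a inc; rewrite ltnNge; apply/negP=> ly.
pose c := x :: take r a; pose z := last x (take r a).
have size_c : size c = r.+1 by rewrite /= size_take; case: ltnP; lia.
have sub_c : {subset c <= x :: a}.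
  by move=> u; rewrite !inE => /predU1P[->|/mem_take->]; rewrite ?eqxx ?orbT.
move: (sa); rewrite /= -{1}(cat_take_drop r a) cat_path => /andP[sc sd].
have := height_sorted sd; rewrite -last_cat cat_take_drop size_drop -/z => hz.
have [|b [sb size_b hb]] := @height_chain y s; first by lia.
apply: (free c b) => // u v uc vb; have [vy hv] := hb v vb.
have yu := inc _ (sub_c _ uc).
apply/negP; rewrite /Order.comparable => /orP[uv|vu].
  by move: yu; rewrite /Order.comparable (le_trans uv vy) orbT.
move: vu; rewrite le_eqVlt => /predU1P[vu|vu].
  by move: yu; rewrite -vu /Order.comparable vy orbT.
by have := height_lt (lt_le_trans vu (sorted_lt_last sc uc)); rewrite -/z; lia.
Qed.

Lemma exists_rank_gap r s : 2 <= r -> 2 <= s -> no_chain_pair r s ->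
  exists (f : P -> nat) (k : nat),
    [/\ {homo f : x y / (x < y)%O >-> x < y},
        forall x a y, sorted <%O (x :: a) -> size a = k.+1 ->
          {in x :: a, forall z, (y >< z)%O} -> f y < f (last x a)
      & k.+1 <= (r - 1) * (s - 1)].
Proof.
case: r => [|[|r]] //; case: s => [|[|s]] // _ _ free.
(* With both parameters shifted by 2, height needs [r + s + 2 <= (r + 1) * (s + 1)], which fails
   exactly when [r] or [s] is 0. *)
have [r0|r0] := posnP r.
  subst r; exists down_card, s; split; last by lia.
    exact: down_card_lt.
  exact: down_card_gap.
have [s0|s0] := posnP s.
  subst s; exists down_card, r; split; last by lia.
    exact: down_card_lt.
  exact/down_card_gap/no_chain_pairC.
exists height, (r + s.+1); split; last by nia.
  exact: height_lt.
exact: (height_gap free).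
Qed.

(** * The wall property of First-Fit and the final count *)

Lemma is_chain_sub (A B : {set P}) : A \subset B -> is_chain B -> is_chain A.
Proof.
move=> /subsetP sAB /forall_inP cB; apply/forall_inP=> x /sAB/cB/forall_inP hx.
by apply/forall_inP=> y /sAB/hx.
Qed.

Lemma is_chainU1 x B : is_chain B -> {in B, forall y, (x >=< y)%O} ->
  is_chain (x |: B).
Proof.
move=> /forall_inP cB xB; apply/forall_inP=> y /setU1P[->|yB];
  apply/forall_inP=> z /setU1P[->|zB]; rewrite ?comparablexx ?xB //.
  by rewrite comparable_sym xB.
by have /forall_inP := cB _ yB; apply.
Qed.

Lemma first_fit_wall (o : seq P) : uniq o ->
  [/\ forall x, (0 < first_fit o x) = (x \in o),
      forall j, 0 < j -> is_chain (color_class (first_fit o) j)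
    & forall x i, 0 < i < first_fit o x ->
        exists2 y, (x >< y)%O & first_fit o y = i].
Proof.
elim/last_ind: o => [_|o x IHo].
  split=> [x|j j0|x i]; rewrite ?ffunE //; last by rewrite ltn0 andbF.
  by apply/forall_inP=> x; rewrite inE ffunE => /eqP j1; rewrite -j1 in j0.
rewrite rcons_uniq => /andP[xo /IHo[hpos hchain hwall]].
rewrite /first_fit foldl_rcons -/(first_fit o).
set c := first_fit o in hpos hchain hwall *.
have cx : c x = 0 by apply/eqP; rewrite -leqn0 leqNgt hpos.
rewrite /ff_step /ff_color; case: ex_minnP => j /andP[j0 cj] minj.
split=> [y|i i0|y i].
- by rewrite ffunE mem_rcons inE; case: eqP => //= _; rewrite hpos.
- have [ij|ij] := eqVneq i j.
    apply: is_chain_sub cj; apply/subsetP=> y; rewrite !inE ffunE ij.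
    by case: (eqVneq y x).
  apply: is_chain_sub (hchain _ i0); apply/subsetP=> y; rewrite !inE ffunE.
  by case: (eqVneq y x) => // _; rewrite eq_sym (negbTE ij).
rewrite ffunE; case: eqP => [->|_] /andP[i0 ij]; last first.
  have [|z yz cz] := hwall y i; first by rewrite i0.
  exists z; rewrite // ffunE; case: eqP => // zx.
  by rewrite -cz zx cx in i0.
(* Minimality of [j] rejects [i]; as the class of [i] is a chain, only a member incomparable to [x]
   can be the obstruction. *)
have : ~~ is_chain (x |: color_class c i).
  apply/negP=> ci; have := minj i.
  by rewrite /admissible i0 ci leqNgt ij => /(_ isT).
have [/exists_inP[z]|] := boolP [exists z in color_class c i, (x >< z)%O].
  rewrite inE => /eqP cz xz _.
  exists z; rewrite // ffunE; case: eqP => // zx.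
  by rewrite -cz zx cx in i0.
rewrite negb_exists_in => /forall_inP hz.
rewrite is_chainU1 ?hchain // => z /hz.
by rewrite negbK.
Qed.

Lemma first_fit_le r s (o : seq P) x : 2 <= r -> 2 <= s -> rs_free r s P ->
  uniq o -> first_fit o x <= 8 * ((r - 1) * (s - 1) * width P).
Proof.
move=> r2 s2 free uo; have [_ _ wall] := first_fit_wall uo.
have {}free := rs_free_no_chain_pair (ltnW r2) free.
have [f [k [f_lt f_gap k_le]]] := exists_rank_gap r2 s2 free.
apply: (@wall_le_bag (\max_x last_rival f x).+1 _ (fun x y => (x >< y)%O)
  (first_fit o) f (last_rival f)) => // [y|y|y z yz|t].
- exact: le_last_rival.
- by rewrite ltnS; apply: leq_bigmax.
- by split; apply: incomparable_le_last_rival; rewrite // comparable_sym.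
- by apply: leq_trans (card_bag f_lt f_gap t) _; rewrite leq_mul2r k_le orbT.
Qed.

Lemma first_fit_classesE (o : seq P) :
  first_fit_classes o = preim_partition (first_fit o) [set: P].
Proof.
apply/setP=> C; apply/imsetP/imsetP=> -[x _ ->]; exists x; rewrite ?inE //;
  by apply/setP=> y; rewrite !inE eq_sym.
Qed.

Lemma card_first_fit_classes (o : seq P) m :
  (forall x, 0 < first_fit o x <= m) -> #|first_fit_classes o| <= m.
Proof.
(* The shift skips colour 0, which marks elements not presented. *)
move=> hm; pose F (i : 'I_m) := color_class (first_fit o) i.+1.
suff /subset_leq_card/leq_trans: first_fit_classes o \subset F @: setT.
  by apply; apply: leq_trans (leq_imset_card _ _) _; rewrite cardsT card_ord.
apply/subsetP=> C /imsetP[x _ ->]; have /andP[x0 xm] := hm x.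
have xm' : (first_fit o x).-1 < m by rewrite prednK.
by apply/imsetP; exists (Ordinal xm'); rewrite // /F /= prednK.
Qed.
End Posets.

Theorem theorem8 (r s w : nat) (hr : 2 <= r) (hs : 2 <= s)
    (d : Order.disp_t) (P : finPOrderType d)
    (hfree : rs_free r s P) (hw : width P = w)
    (o : seq P) (o_uniq : uniq o) (o_all : forall x : P, x \in o) :
  [/\ partition (first_fit_classes o) [set: P],
      forall C : {set P}, C \in first_fit_classes o -> is_chain C
    & #|first_fit_classes o| <= 8 * (r - 1) * (s - 1) * w].
Proof.
have [hpos hchain _] := first_fit_wall o_uniq.
split.
- by rewrite first_fit_classesE preim_partitionP.
- by move=> C /imsetP[x _ ->]; apply: hchain; rewrite hpos.
- apply: card_first_fit_classes => x; rewrite hpos o_all /= -hw -!mulnA.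
  by rewrite (mulnA (r - 1)); apply: first_fit_le.
Qed.
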